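(* Let $\delta>0$, $\mu,\gamma\in\mathbb{R}$, $g\in l^2$, and let $K_\phi>0$ be a constant. For every $t_0>0$ there exist a small $\epsilon_0>0$ and positive constants $C_0$ and $C$ such that for every $\epsilon\in(0,\epsilon_0)$ for which the initial condition $\psi(0)\in l^2$ of the dfAL, the initial condition $\phi(0)\in l^2$ of the dfDNLS, and $g$ satisfy $$\|\phi(0)-\psi(0)\|_{l^2}\le C_0\,\epsilon^3$$ and $$\frac{2}{\delta}\|g\|_{l^2}\le\|\phi(0)\|_{l^2}\le K_\phi\,\epsilon,$$ the corresponding solutions $\psi(t)$ of the dfAL and $\phi(t)$ of the dfDNLS fulfill, for every $t\in[0,t_0]$, $$\|\phi(t)-\psi(t)\|_{l^2}\le C\,\epsilon^3.$$
   Context: $l^2$ is the Hilbert space of complex sequences $\varphi=(\varphi_n)_{n\in\mathbb{Z}}$ with $\|\varphi\|_{l^2}=(\sum_{n\in\mathbb{Z}}|\varphi_n|^2)^{1/2}<\infty$. The damped and forced Ablowitz-Ladik equation (dfAL) is $$i\frac{d\psi_n}{dt}=(\psi_{n+1}-2\psi_n+\psi_{n-1})+\mu|\psi_n|^2(\psi_{n+1}+\psi_{n-1})-i\delta\psi_n+g_n,\quad n\in\mathbb{Z},$$ and the damped and forced discrete nonlinear Schrödinger equation (dfDNLS) is $$i\frac{d\phi_n}{dt}=(\phi_{n+1}-2\phi_n+\phi_{n-1})+\gamma|\phi_n|^2\phi_n-i\delta\phi_n+g_n,\quad n\in\mathbb{Z},$$ with the same $\delta>0$ and the same external force $g=(g_n)_{n\in\mathbb{Z}}$.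 Solutions are understood in $C^1([0,\infty);l^2)$. *)

(* Defs.v *)
From mathcomp Require Import all_boot all_order all_algebra.
From mathcomp Require Import all_classical all_reals all_analysis.
From mathcomp Require Export complex.
Set Implicit Arguments.
Unset Strict Implicit.
Unset Printing Implicit Defensive.
Import Order.TTheory GRing.Theory Num.Theory.
Import numFieldNormedType.Exports.
Local Open Scope classical_set_scope.
Local Open Scope complex_scope.
Local Open Scope ring_scope.

(* [ComplexField.Normc.normc z] is the modulus of [z] as an element of [R]
   (whereas [`|z|] is the same number seen in [R[i]]). *)
Definition l2sum (R : realType) (u : int -> R[i]) : \bar R :=
  (\esum_(n in [set: int]) ((ComplexField.Normc.normc (u n)) ^+ 2)%:E)%R.

Definition in_l2 (R : realType) (u : int -> R[i]) : Prop :=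
  (l2sum u < +oo)%E.

(* The value on sequences outside l^2 is meaningless ([fine +oo = 0]). *)
Definition l2norm (R : realType) (u : int -> R[i]) : R :=
  Num.sqrt (fine (l2sum u)).

(* [is_C1_l2 u du]: the restriction of [u] to [0, +oo[ belongs to
   C^1([0, +oo[; l^2) and has derivative [du] there.  Limits are taken in the
   l^2 norm; those at t = 0 are one-sided, and [u] and [du] are unconstrained
   at negative times. *)
Definition is_C1_l2 (R : realType) (u du : R -> int -> R[i]) : Prop :=
  forall t : R, 0 <= t ->
  [/\ in_l2 (u t), in_l2 (du t),
      l2norm (fun n => (s - t)^-1%:C * (u s n - u t n) - du t n)
        @[s --> within [set s | 0 <= s] t^'] --> (0 : R) &
      l2norm (fun n => du s n - du t n)
        @[s --> within [set s | 0 <= s] (nbhs t)] --> (0 : R)].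

Definition dfAL_solution (R : realType) (delta mu : R) (g : int -> R[i])
    (psi : R -> int -> R[i]) : Prop :=
  exists2 dpsi : R -> int -> R[i], is_C1_l2 psi dpsi &
    forall (t : R) (n : int), 0 <= t ->
      'i%C * dpsi t n =
        (psi t (n + 1) - 2 * psi t n + psi t (n - 1))
        + mu%:C * `|psi t n| ^+ 2 * (psi t (n + 1) + psi t (n - 1))
        - 'i%C * delta%:C * psi t n + g n.

Definition dfDNLS_solution (R : realType) (delta gamma : R) (g : int -> R[i])
    (phi : R -> int -> R[i]) : Prop :=
  exists2 dphi : R -> int -> R[i], is_C1_l2 phi dphi &
    forall (t : R) (n : int), 0 <= t ->
      'i%C * dphi t n =
        (phi t (n + 1) - 2 * phi t n + phi t (n - 1))
        + gamma%:C * `|phi t n| ^+ 2 * phi t n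
        - 'i%C * delta%:C * phi t n + g n.

(* Main.v *)
Require Import Defs.
From mathcomp Require Import all_boot all_order all_algebra.
From mathcomp Require Import all_classical all_reals all_analysis.
From mathcomp Require Import ring lra.
Set Implicit Arguments.
Unset Strict Implicit.
Unset Printing Implicit Defensive.
Import Order.TTheory GRing.Theory Num.Theory.
Import numFieldNormedType.Exports.
Local Open Scope classical_set_scope.
Local Open Scope ring_scope.

(** Both equations, and the equation for phi - psi, have the form
    i u' = (discrete Laplacian of u) - i delta u + w.  For the real inner
    product of l^2 the Laplacian does no work, so Re <u, u'> is at most
    - delta |u|^2 + |u| |w|, and a sphere |u| = b on which |w| < delta b
    cannot be crossed outwards.  For small eps this traps phi and psi in the
    ball of radius (K_phi + 1) eps, the source being the cubic term plus g, with
    |g| <= delta K_phi eps / 2.  In the difference g cancels and the source is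
    of order eps^3, which traps phi - psi in a ball of radius C eps^3, for all
    times and with constants that depend on neither t0 nor g. *)

(** * Sums of absolutely summable real families *)

Section Summation.
Variables (R : realType) (T : choiceType).
Implicit Types f g p q : T -> R.

Definition abssum f : Prop := (\esum_(n in [set: T]) (`|f n|)%:E < +oo)%E.

(** Intended for nonnegative families; [fine] sends an infinite sum to 0, hence the [abssum]
    hypotheses in what follows. *)
Definition nnsum f : R := fine (\esum_(n in [set: T]) (f n)%:E).

(* Meaningful for absolutely summable families only. *)
Definition sumR f : R :=
  nnsum (fun n => `|f n| + f n) - nnsum (fun n => `|f n|).

Lemma eq_nnsum f g : f =1 g -> nnsum f = nnsum g.
Proof. by move=> /funext ->. Qed.

Lemma eq_sumR f g : f =1 g -> sumR f = sumR g.
Proof. by move=> /funext ->. Qed.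

Lemma abssum_le f g : (forall n, `|f n| <= `|g n|) -> abssum g -> abssum f.
Proof. by move=> fg; apply: le_lt_trans; apply: le_esum => n _; rewrite lee_fin. Qed.

Lemma abssumD f g : abssum f -> abssum g -> abssum (fun n => f n + g n).
Proof.
move=> hf hg; apply: le_lt_trans (lte_add_pinfty hf hg).
rewrite -esumD; try by move=> n _; rewrite lee_fin.
by apply: le_esum => n _; rewrite -EFinD lee_fin ler_normD.
Qed.

(** Checked on finite partial sums. The converse inequality comes in [nnsumZ], by scaling back with
    [c^-1]. *)
Lemma esum_scale_le (c : R) f : 0 <= c -> (forall n, 0 <= f n) ->
  (\esum_(n in [set: T]) (c * f n)%:E <= c%:E * \esum_(n in [set: T]) (f n)%:E)%E.
Proof.
move=> c0 f0; apply: ge_ereal_sup => _ [X [finX _]] <-.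
under eq_fsbigr do rewrite EFinM.
rewrite -ge0_mule_fsumr; last by move=> n; rewrite lee_fin.
by apply: lee_wpmul2l; [rewrite lee_fin | apply: esum_ge; exists X].
Qed.

Lemma abssumZ c f : abssum f -> abssum (fun n => c * f n).
Proof.
move=> hf; rewrite /abssum; under eq_esum do rewrite normrM.
apply: le_lt_trans (esum_scale_le _ _) _ => //.
by rewrite lte_mul_pinfty// lee_fin.
Qed.

Lemma abssumN f : abssum f -> abssum (fun n => - f n).
Proof. by apply: abssum_le => n; rewrite normrN. Qed.

Lemma abssum_reindex (e : T -> T) f : bijective e ->
  abssum f -> abssum (f \o e).
Proof.
move=> be; rewrite /abssum (@reindex_esum _ _ _ setT setT e)//.
by rewrite setTT_bijective.
Qed.

Lemma esum_nnE f : (forall n, 0 <= f n) -> abssum f ->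
  \esum_(n in [set: T]) (f n)%:E = (nnsum f)%:E.
Proof.
move=> f0 hf; rewrite fineK// ge0_fin_numE; last by apply: esum_ge0 => n _; rewrite lee_fin.
by move: hf; rewrite /abssum; under eq_esum do rewrite ger0_norm//.
Qed.

Lemma nnsum_ge0 f : (forall n, 0 <= f n) -> 0 <= nnsum f.
Proof. by move=> f0; apply/fine_ge0/esum_ge0 => n _; rewrite lee_fin. Qed.

Lemma nnsumD f g : (forall n, 0 <= f n) -> (forall n, 0 <= g n) ->
  abssum f -> abssum g -> nnsum (fun n => f n + g n) = nnsum f + nnsum g.
Proof.
move=> f0 g0 hf hg; apply: EFin_inj; rewrite EFinD -!esum_nnE//.
- by rewrite -esumD// => n _; rewrite lee_fin.
- by move=> n; rewrite addr_ge0.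
- exact: abssumD.
Qed.

Lemma nnsumZ (c : R) f : 0 <= c -> (forall n, 0 <= f n) -> abssum f ->
  nnsum (fun n => c * f n) = c * nnsum f.
Proof.
have le d g : 0 <= d -> (forall n, 0 <= g n) -> abssum g ->
    nnsum (fun n => d * g n) <= d * nnsum g.
  move=> d0 g0 hg; rewrite -lee_fin EFinM -!esum_nnE//; first exact: esum_scale_le.
    by move=> n; rewrite mulr_ge0.
  exact: abssumZ.
move=> c0 f0 hf; apply/eqP; rewrite eq_le le//=.
have [->|cN0] := eqVneq c 0.
  by rewrite mul0r; apply: nnsum_ge0 => n; rewrite mul0r.
have cp : 0 < c by rewrite lt_neqAle eq_sym cN0.
rewrite -ler_pdivlMl//.
have := le c^-1 (fun n => c * f n); rewrite invr_ge0 => /(_ c0).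
under [X in X <= _]eq_nnsum do rewrite mulKf//.
by apply=> [n|]; [rewrite mulr_ge0 | exact: abssumZ].
Qed.

Lemma abssum_norm f : abssum f -> abssum (fun n => `|f n|).
Proof. by apply: abssum_le => n; rewrite normr_id. Qed.

Lemma addr_norm_ge0 (x : R) : 0 <= `|x| + x.
Proof. by have := ler_norm (- x); rewrite normrN; lra. Qed.

(** The pieces [a] and [b] in the definition of [sumR] satisfy [a + q = b + p] pointwise, so that
    only sums of nonnegative families are added. Linearity of [sumR] rests on this freedom to choose
    the splitting. *)
Lemma sumR_diff p q : (forall n, 0 <= p n) -> (forall n, 0 <= q n) ->
  abssum p -> abssum q -> sumR (fun n => p n - q n) = nnsum p - nnsum q.
Proof.
move=> p0 q0 hp hq; rewrite /sumR.
pose a n : R := `|p n - q n| + (p n - q n); pose b n : R := `|p n - q n|.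
rewrite -/a -/b.
have a0 n : 0 <= a n by exact: addr_norm_ge0.
have b0 n : 0 <= b n by exact: normr_ge0.
have hpq : abssum (fun n => p n - q n).
  by apply: abssumD => //; apply: abssum_le hq => n; rewrite normrN.
have hb : abssum b by exact: abssum_norm.
have ha : abssum a by exact: abssumD.
suff : nnsum a + nnsum q = nnsum b + nnsum p by lra.
by rewrite -!nnsumD//; apply: eq_nnsum => n; rewrite /a /b; lra.
Qed.

Lemma sumRD f g : abssum f -> abssum g ->
  sumR (fun n => f n + g n) = sumR f + sumR g.
Proof.
move=> hf hg; have [nf ng] := (abssum_norm hf, abssum_norm hg).
pose F n : R := `|f n| + f n; pose G n : R := `|g n| + g n.
have [F0 G0] : (forall n, 0 <= F n) /\ (forall n, 0 <= G n).
  by split=> n; exact: addr_norm_ge0.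
have [hF hG] : abssum F /\ abssum G by split; exact: abssumD.
rewrite (@eq_sumR _ (fun n => (F n + G n) - (`|f n| + `|g n|))).
  rewrite sumR_diff.
  - rewrite (nnsumD F0 G0)// [X in _ - X]nnsumD//.
    have -> : sumR f = nnsum F - nnsum (fun n => `|f n|) by [].
    have -> : sumR g = nnsum G - nnsum (fun n => `|g n|) by [].
    by lra.
  - by move=> n; rewrite addr_ge0.
  - by move=> n; rewrite addr_ge0.
  - exact: abssumD.
  - exact: abssumD.
by move=> n /=; rewrite /F /G; lra.
Qed.

Lemma sumRN f : abssum f -> sumR (fun n => - f n) = - sumR f.
Proof.
move=> hf; have nf := abssum_norm hf.
(* The two pieces of the splitting of [f] trade places. *)
rewrite (@eq_sumR _ (fun n => `|f n| - (`|f n| + f n))); last by move=> n /=; lra.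
rewrite sumR_diff//; first by rewrite /sumR opprB.
- by move=> n; exact: addr_norm_ge0.
- exact: abssumD.
Qed.

Lemma sumRZ c f : abssum f -> sumR (fun n => c * f n) = c * sumR f.
Proof.
move=> hf; have nf := abssum_norm hf.
wlog c0 : c / 0 <= c.
  move=> H; have [|c0] := leP 0 c; first exact: H.
  rewrite (@eq_sumR _ (fun n => - (- c * f n))); last by move=> n /=; lra.
  rewrite sumRN; last exact: abssumZ.
  by rewrite H ?mulNr ?opprK//; lra.
rewrite (@eq_sumR _ (fun n => c * (`|f n| + f n) - c * `|f n|)); last first.
  by move=> n /=; lra.
have ha : abssum (fun n => `|f n| + f n) by exact: abssumD.
rewrite sumR_diff ?nnsumZ//; first by rewrite /sumR; lra.
- by move=> n; exact: addr_norm_ge0.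
- by move=> n; rewrite mulr_ge0// addr_norm_ge0.
- by move=> n; rewrite mulr_ge0.
- exact: abssumZ.
- exact: abssumZ.
Qed.

Lemma sumR_nn f : (forall n, 0 <= f n) -> abssum f -> sumR f = nnsum f.
Proof.
move=> f0 hf; rewrite /sumR nnsumD//; last exact: abssum_norm.
by rewrite addrC addKr.
Qed.

Lemma sumR_ge0 f : (forall n, 0 <= f n) -> abssum f -> 0 <= sumR f.
Proof. by move=> f0 hf; rewrite sumR_nn// nnsum_ge0. Qed.

Lemma sumR_le f g : abssum f -> abssum g -> (forall n, f n <= g n) ->
  sumR f <= sumR g.
Proof.
move=> hf hg fg; rewrite -subr_ge0 -sumRN// -sumRD//; last exact: abssumN.
by apply: sumR_ge0 => [n|]; [rewrite subr_ge0 | apply: abssumD => //; exact: abssumN].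
Qed.

Lemma sumR_reindex (e : T -> T) f : bijective e -> sumR (f \o e) = sumR f.
Proof.
move=> be; have H g : nnsum g = nnsum (g \o e).
  by rewrite /nnsum (@reindex_esum _ _ _ setT setT e)// setTT_bijective.
by rewrite /sumR [X in _ = X - _]H [X in _ = _ - X]H.
Qed.

(** A singleton is one of the finite sets over which the supremum is taken. *)
Lemma term_le_sumR f (m : T) : (forall n, 0 <= f n) -> abssum f -> f m <= sumR f.
Proof.
move=> f0 hf; rewrite sumR_nn// -lee_fin -esum_nnE//.
by apply: esum_ge; exists [set m]; [|rewrite fsbig_set1].
Qed.
End Summation.

(** * The real Hilbert space structure of $l^2$ *)

Section L2.
Variable R : realType.
Implicit Types (z w : R[i]) (u v : int -> R[i]) (c : R).
Local Notation normc := ComplexField.Normc.normc.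

(** The real part of [z] times the conjugate of [w]: the inner product of the complex plane seen as
    a real plane. *)
Definition rip z w : R := complex.Re z * complex.Re w + complex.Im z * complex.Im w.

Lemma normc_ge0 z : 0 <= normc z.
Proof. by case: z => a b; exact: sqrtr_ge0. Qed.

Lemma normcN z : normc (- z) = normc z.
Proof. by case: z => a b /=; rewrite !sqrrN. Qed.

Lemma normc_sqr z : normc z ^+ 2 = rip z z.
Proof. by case: z => a b; rewrite /rip /= sqr_sqrtr ?addr_ge0 ?sqr_ge0// !expr2. Qed.

Lemma rip_ge0 z : 0 <= rip z z.
Proof. by rewrite -normc_sqr sqr_ge0. Qed.

Lemma ripC z w : rip z w = rip w z.
Proof. by rewrite /rip; ring. Qed.

Lemma ripDr z w x : rip z (w + x) = rip z w + rip z x.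
Proof. by case: z w x => [a b] [d e] [f g]; rewrite /rip /=; ring. Qed.

Lemma ripZr c z w : rip z (c%:C%C * w) = c * rip z w.
Proof. by case: z w => [a b] [d e]; rewrite /rip /=; ring. Qed.

(** A crude bound from the squares of [z + w] and [z - w], enough to make products of $l^2$
    sequences summable; the sharp estimate is [dot_le]. *)
Lemma rip_le z w : `|rip z w| <= rip z z + rip w w.
Proof.
case: z w => [a b] [d e]; rewrite /rip /= ler_norml.
have [h1 h2] := (sqr_ge0 (a + d), sqr_ge0 (b + e)).
have [h3 h4] := (sqr_ge0 (a - d), sqr_ge0 (b - e)).
have [[h5 h6] [h7 h8]] := ((sqr_ge0 a, sqr_ge0 b), (sqr_ge0 d, sqr_ge0 e)).
by apply/andP; split; lra.
Qed.

Lemma ripD_le z w : rip (z + w) (z + w) <= 2 * (rip z z + rip w w).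
Proof.
case: z w => [a b] [d e]; rewrite /rip /=.
by have := (sqr_ge0 (a - d), sqr_ge0 (b - e)); case; lra.
Qed.

Definition dot u v : R := sumR (fun n => rip (u n) (v n)).

Lemma in_l2E u : in_l2 u <-> abssum (fun n => rip (u n) (u n)).
Proof.
rewrite /in_l2 /abssum (_ : l2sum u = \esum_(n in [set: int]) `|rip (u n) (u n)|%:E)//.
by apply: eq_esum => n _; rewrite ger0_norm ?rip_ge0// normc_sqr.
Qed.

Lemma l2norm_ge0 u : 0 <= l2norm u.
Proof. exact: sqrtr_ge0. Qed.

Lemma dot_self u : in_l2 u -> dot u u = l2norm u ^+ 2.
Proof.
move=> /in_l2E hu; have h0 n := rip_ge0 (u n).
rewrite /l2norm sqr_sqrtr; last by apply/fine_ge0/esum_ge0 => n _; rewrite lee_fin sqr_ge0.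
by rewrite /dot sumR_nn// /l2sum; congr fine; apply: eq_esum => n _; rewrite normc_sqr.
Qed.

Lemma eq_l2norm u v : u =1 v -> l2norm u = l2norm v.
Proof. by move=> /funext ->. Qed.

Lemma abssum_rip u v : in_l2 u -> in_l2 v -> abssum (fun n => rip (u n) (v n)).
Proof.
move=> /in_l2E hu /in_l2E hv; apply: abssum_le (abssumD hu hv) => n.
by rewrite (le_trans (rip_le _ _))// ler_norm.
Qed.

Lemma in_l2D u v : in_l2 u -> in_l2 v -> in_l2 (fun n => u n + v n).
Proof.
move=> /in_l2E hu /in_l2E hv; apply/in_l2E.
apply: abssum_le (abssumZ 2 (abssumD hu hv)) => n.
by rewrite ger0_norm ?rip_ge0// (le_trans (ripD_le _ _))// ler_norm.
Qed.

Lemma normc_le_rip c z w : 0 <= c -> normc z <= c * normc w ->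
  rip z z <= c ^+ 2 * rip w w.
Proof.
by move=> c0 h; rewrite -!normc_sqr -exprMn lerXn2r// nnegrE ?mulr_ge0 ?normc_ge0.
Qed.

(** Scalar multiples, the factor ['i] and the cubic terms all enter $l^2$ through this domination,
    and [l2norm_dom] bounds their norms. *)
Lemma in_l2_dom c u v : 0 <= c -> (forall n, normc (v n) <= c * normc (u n)) ->
  in_l2 u -> in_l2 v.
Proof.
move=> c0 uv /in_l2E hu; apply/in_l2E; apply: abssum_le (abssumZ (c ^+ 2) hu) => n.
by rewrite ger0_norm ?rip_ge0// (le_trans (normc_le_rip c0 (uv n)))// ler_norm.
Qed.

Lemma l2norm_dom c u v : 0 <= c -> (forall n, normc (v n) <= c * normc (u n)) ->
  in_l2 u -> l2norm v <= c * l2norm u.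
Proof.
move=> c0 uv hu; have hv := in_l2_dom c0 uv hu.
rewrite -(@ler_pXn2r _ 2)// ?nnegrE ?mulr_ge0 ?l2norm_ge0//.
rewrite exprMn -!dot_self// /dot -sumRZ; last exact: abssum_rip.
apply: sumR_le => [||n]; [exact: abssum_rip| |exact: normc_le_rip].
by apply: abssumZ; exact: abssum_rip.
Qed.

Lemma normcZ c z : normc (c%:C%C * z) = `|c| * normc z.
Proof. by rewrite ComplexField.Normc.normcM /= expr0n addr0 sqrtr_sqr. Qed.

Lemma in_l2Z c u : in_l2 u -> in_l2 (fun n => c%:C%C * u n).
Proof. by apply: (@in_l2_dom `|c|) => // n; rewrite normcZ. Qed.

Lemma in_l2i u : in_l2 u -> in_l2 (fun n => 'i%C * u n).
Proof.
apply: (@in_l2_dom 1) => // n.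
by rewrite ComplexField.Normc.normcM /= expr0n expr1n add0r sqrtr1.
Qed.

Lemma l2normi u : in_l2 u -> l2norm (fun n => 'i%C * u n) <= l2norm u.
Proof.
move=> hu; rewrite -[leRHS]mul1r; apply: l2norm_dom => // n.
by rewrite ComplexField.Normc.normcM /= expr0n expr1n add0r sqrtr1.
Qed.

Lemma l2normZ_le c u : in_l2 u -> l2norm (fun n => c%:C%C * u n) <= `|c| * l2norm u.
Proof. by move=> hu; apply: l2norm_dom => // n; rewrite normcZ. Qed.

Lemma in_l2N u : in_l2 u -> in_l2 (fun n => - u n).
Proof.
by apply: (@in_l2_dom 1) => // n; rewrite normcN mul1r.
Qed.

Lemma in_l2B u v : in_l2 u -> in_l2 v -> in_l2 (fun n => u n - v n).
Proof. by move=> hu hv; apply: in_l2D => //; exact: in_l2N. Qed.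

Lemma l2normN u : l2norm (fun n => - u n) = l2norm u.
Proof.
rewrite /l2norm /l2sum; congr (Num.sqrt (fine _)); apply: eq_esum => n _.
by rewrite normcN.
Qed.

Lemma bij_addz (m : int) : bijective (fun n : int => n + m).
Proof. by exists (fun n => n - m) => n; rewrite ?addrK ?subrK. Qed.

Lemma in_l2_shift m u : in_l2 u -> in_l2 (fun n => u (n + m)).
Proof.
move=> /in_l2E hu; apply/in_l2E.
exact: (@abssum_reindex _ _ _ (fun n => rip (u n) (u n)) (bij_addz m)).
Qed.

Lemma dot_shift m u v : dot (fun n => u (n + m)) (fun n => v (n + m)) = dot u v.
Proof. exact: (@sumR_reindex _ _ _ (fun n => rip (u n) (v n)) (bij_addz m)). Qed.

Lemma l2norm_shift m u : in_l2 u -> l2norm (fun n => u (n + m)) = l2norm u.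
Proof.
move=> hu; apply/eqP; rewrite -(@eqrXn2 _ 2) ?l2norm_ge0//.
by rewrite -!dot_self ?dot_shift//; exact: in_l2_shift.
Qed.

Lemma dotC u v : dot u v = dot v u.
Proof. by apply: eq_sumR => n; rewrite ripC. Qed.

Lemma dotDr u v x : in_l2 u -> in_l2 v -> in_l2 x ->
  dot u (fun n => v n + x n) = dot u v + dot u x.
Proof.
move=> hu hv hw; rewrite /dot -sumRD; try exact: abssum_rip.
by apply: eq_sumR => n; rewrite ripDr.
Qed.

Lemma dotZr c u v : in_l2 u -> in_l2 v ->
  dot u (fun n => c%:C%C * v n) = c * dot u v.
Proof.
move=> hu hv; rewrite /dot -sumRZ; last exact: abssum_rip.
by apply: eq_sumR => n; rewrite ripZr.
Qed.

Lemma l2normZ_sqr c u : in_l2 u ->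
  l2norm (fun n => c%:C%C * u n) ^+ 2 = c ^+ 2 * l2norm u ^+ 2.
Proof.
move=> hu; have hcu := in_l2Z c hu.
by rewrite -!dot_self// dotZr// dotC dotZr// mulrA expr2.
Qed.

Lemma dotDD u v : in_l2 u -> in_l2 v ->
  l2norm (fun n => u n + v n) ^+ 2 = l2norm u ^+ 2 + 2 * dot u v + l2norm v ^+ 2.
Proof.
move=> hu hv; have huv := in_l2D hu hv.
rewrite -dot_self// dotDr// dotC dotDr// [X in _ + X]dotC dotDr// !dot_self//.
by rewrite (dotC v u); ring.
Qed.

(** The sup norm is at most the $l^2$ norm; this is what makes the cubic terms bounded in $l^2$. *)
Lemma normc_le_l2norm u n : in_l2 u -> normc (u n) <= l2norm u.
Proof.
move=> hu; rewrite -(@ler_pXn2r _ 2)// ?nnegrE ?normc_ge0 ?l2norm_ge0//.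
rewrite -dot_self// normc_sqr.
apply: (@term_le_sumR _ _ (fun n => rip (u n) (u n))) => [k|]; first exact: rip_ge0.
exact: abssum_rip.
Qed.

Lemma l2norm_eq0 u n : in_l2 u -> l2norm u = 0 -> u n = 0.
Proof.
move=> hu u0; apply: ComplexField.Normc.eq0_normc; apply/eqP.
by rewrite eq_le normc_ge0 andbT -[leRHS]u0 normc_le_l2norm.
Qed.

(** Cauchy-Schwarz: with [a] and [b] the norms of [u] and [v], the squared norm of [b u - a v]
    equals [2 * (a * b * (a * b - dot u v))]. *)
Lemma dot_le u v : in_l2 u -> in_l2 v -> dot u v <= l2norm u * l2norm v.
Proof.
move=> hu hv; set a := l2norm u; set b := l2norm v.
have [a0 b0] : 0 <= a /\ 0 <= b by rewrite !l2norm_ge0.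
(* The final division by [a * b] requires nonzero norms; a sequence of norm zero vanishes and is
   treated apart. *)
have [a0'|ap] := eqVneq a 0.
  rewrite a0' mul0r /dot (@eq_sumR _ _ _ (fun n => 0 * rip (u n) (v n))).
    by rewrite sumRZ ?mul0r//; exact: abssum_rip.
  by move=> n; rewrite l2norm_eq0// /rip /= !mul0r addr0.
have [b0'|bp] := eqVneq b 0.
  rewrite b0' mulr0 /dot (@eq_sumR _ _ _ (fun n => 0 * rip (u n) (v n))).
    by rewrite sumRZ ?mul0r//; exact: abssum_rip.
  by move=> n; rewrite (@l2norm_eq0 v)// /rip /= !mulr0 addr0 mul0r.
have hbu := in_l2Z b hu; have hav := in_l2Z (- a) hv.
have := sqr_ge0 (l2norm (fun n => b%:C%C * u n + (- a)%:C%C * v n)).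
rewrite (dotDD hbu hav) (l2normZ_sqr b hu) (l2normZ_sqr (- a) hv).
rewrite (dotZr (- a) hbu hv) dotC (dotZr b hv hu) dotC -/a -/b => h.
have abp : 0 < a * b by rewrite mulr_gt0// lt0r ?ap ?bp.
rewrite -subr_ge0 -(pmulr_rge0 _ abp); move: h.
have -> : b ^+ 2 * a ^+ 2 + 2 * (- a * (b * dot u v)) + (- a) ^+ 2 * b ^+ 2 =
  2 * (a * b * (a * b - dot u v)) by ring.
by move: (_ * _ * (_ - _)) => x; lra.
Qed.

Lemma l2normD u v : in_l2 u -> in_l2 v ->
  l2norm (fun n => u n + v n) <= l2norm u + l2norm v.
Proof.
move=> hu hv; rewrite -(@ler_pXn2r _ 2)// ?nnegrE ?addr_ge0 ?l2norm_ge0//.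
by rewrite dotDD//; have := dot_le hu hv; lra.
Qed.

Lemma l2normB u v : in_l2 u -> in_l2 v ->
  l2norm (fun n => u n - v n) <= l2norm u + l2norm v.
Proof.
by move=> hu hv; rewrite -(l2normN v); apply: l2normD => //; exact: in_l2N.
Qed.

Lemma l2norm_dist u v : in_l2 u -> in_l2 v ->
  `|l2norm u - l2norm v| <= l2norm (fun n => u n - v n).
Proof.
move=> hu hv; have huv := in_l2B hu hv.
have := l2normD huv hv; have := l2normB hu huv.
rewrite [X in X <= _](@eq_l2norm _ v); last by move=> n; rewrite subKr.
rewrite [X in _ -> X <= _ -> _](@eq_l2norm _ u); last by move=> n; rewrite subrK.
by rewrite ler_norml => h1 h2; apply/andP; split; lra.
Qed.

End L2.

(** * Differentiable curves in $l^2$ and the barrier principle *)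

Section Evolution.
Variable R : realType.
Implicit Types (z w : R[i]) (u v du dv : R -> int -> R[i]).
Local Notation normc := ComplexField.Normc.normc.

(** If [f t] exceeded [b], the last time [m] before [t] with [f m <= b] would satisfy [f m = b] by
    continuity, and the second hypothesis would keep [f] below [b] a little longer. *)
Lemma barrier (f : R -> R) (b : R) :
  (forall t, 0 <= t -> forall e : R, 0 < e -> exists2 rho : R, 0 < rho &
    forall s, 0 <= s -> `|s - t| < rho -> `|f s - f t| < e) ->
  (forall t, 0 <= t -> f t = b -> exists2 rho, 0 < rho &
    forall s, t < s -> s < t + rho -> f s <= b) ->
  f 0 <= b -> forall t, 0 <= t -> f t <= b.
Proof.
move=> fcont fbar f0 t t0; rewrite leNgt; apply/negP => ft.
pose S := [set s | 0 <= s <= t /\ f s <= b].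
have S0 : S 0 by split=> //; rewrite lexx.
have hS : has_sup S by split; [exists 0 | exists t => s [/andP[]]].
have /andP[m0 mt] : 0 <= sup S <= t.
  rewrite ub_le_sup//=; last by case: hS.
  by apply: ge_sup; [exists 0 | move=> s [/andP[]]].
set m := sup S in m0 mt.
have above s : m < s -> s <= t -> b < f s.
  move=> ms st; rewrite ltNge; apply/negP => fs.
  have : s <= m.
    apply: ub_le_sup; first by case: hS.
    by split=> //; rewrite st (le_trans m0 (ltW ms)).
  by rewrite leNgt ms.
(* Otherwise [f] would exceed [b] near [m], although points of [S] lie arbitrarily close to the
   supremum. *)
have fm : f m <= b.
  rewrite leNgt; apply/negP => fm.
  have [|rho rho0 H] := fcont m m0 (f m - b); first by rewrite subr_gt0.
  have [s Ss ms] := sup_adherent rho0 hS.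
  have sm : s <= m by apply: ub_le_sup => //; case: hS.
  case: Ss => /andP[s0 _] fs.
  have := H s s0; rewrite ler0_norm ?subr_le0//.
  have -> : - (s - m) < rho by rewrite /m; lra.
  move=> /(_ isT); rewrite ltr_norml => /andP[+ _]; lra.
have mt' : m < t.
  by rewrite lt_neqAle mt andbT; apply: contraTneq ft => <-; rewrite -leNgt.
(* Otherwise [f] would stay below [b] just after [m], against [above]. The minimum with [t] keeps
   [s] in the range of [above]. *)
have fmb : f m = b.
  apply/eqP; rewrite eq_le fm /= leNgt; apply/negP => fm'.
  have [|rho rho0 H] := fcont m m0 (b - f m); first by rewrite subr_gt0.
  pose s := Num.min t (m + rho / 2).
  have ms : m < s by rewrite lt_min mt' /=; lra.
  have st : s <= t by rewrite ge_min lexx.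
  have sr : s <= m + rho / 2 by rewrite ge_min lexx orbT.
  have := H s (le_trans m0 (ltW ms)); rewrite gtr0_norm ?subr_gt0//.
  have -> : s - m < rho by lra.
  by move=> /(_ isT); rewrite ltr_norml => /andP[_]; have := above s ms st; lra.
have [rho rho0 H] := fbar m m0 fmb.
pose s := Num.min t (m + rho / 2).
have ms : m < s by rewrite lt_min mt' /=; lra.
have st : s <= t by rewrite ge_min lexx.
have sr : s <= m + rho / 2 by rewrite ge_min lexx orbT.
have := above s ms st; have := H s ms; lra.
Qed.

Definition diffq u du (t s : R) (n : int) : R[i] :=
  (s - t)^-1%:C%C * (u s n - u t n) - du t n.

(** Differentiability in the $l^2$ norm in epsilon form, one-sided at time 0. *)
Definition l2_derivative u du : Prop := forall t : R, 0 <= t ->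
  [/\ in_l2 (u t), in_l2 (du t) &
    forall e : R, 0 < e -> exists2 rho : R, 0 < rho &
      forall s : R, 0 <= s -> s != t -> `|s - t| < rho -> l2norm (diffq u du t s) < e].

Lemma is_C1_l2_derivative u du : is_C1_l2 u du -> l2_derivative u du.
Proof.
move=> hu t t0; have [h1 h2 h3 _] := hu t t0; split=> // e e0.
move/cvgrPdist_lt : h3 => /(_ e e0); rewrite near_withinE.
rewrite /dnbhs near_withinE => /nbhs_ballP[rho /= rho0 H]; exists rho => // s s0 st sr.
have := H s; rewrite /ball /= distrC => /(_ sr st s0).
by rewrite sub0r normrN ger0_norm ?l2norm_ge0.
Qed.

Lemma in_l2_diffq u du t s : l2_derivative u du -> 0 <= t -> 0 <= s ->
  in_l2 (diffq u du t s).
Proof.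
move=> hu t0 s0; have [h1 h2 _] := hu t t0; have [h3 _ _] := hu s s0.
by apply: in_l2B => //; apply: in_l2Z; apply: in_l2B.
Qed.

(** The first-order expansion at [t] as an exact identity, with [diffq] as error term. *)
Lemma diffq_expand u du t s n : s != t ->
  u s n = u t n + (s - t)%:C%C * (du t n + diffq u du t s n).
Proof.
move=> st; rewrite /diffq subrKC mulrA -rmorphM /= divff ?subr_eq0//.
by rewrite rmorph1 mul1r subrKC.
Qed.

Lemma l2_derivativeB u du v dv : l2_derivative u du -> l2_derivative v dv ->
  l2_derivative (fun t n => u t n - v t n) (fun t n => du t n - dv t n).
Proof.
move=> hu hv t t0; have [u1 u2 u3] := hu t t0; have [v1 v2 v3] := hv t t0.
split; [exact: in_l2B | exact: in_l2B |] => e e0.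
have e2 : 0 < e / 2 by lra.
have [r1 r10 H1] := u3 _ e2; have [r2 r20 H2] := v3 _ e2.
exists (Num.min r1 r2); first by rewrite lt_min r10.
move=> s s0 st; rewrite lt_min => /andP[sr1 sr2].
rewrite (@eq_l2norm _ _ (fun n => diffq u du t s n - diffq v dv t s n)); last first.
  by move=> n; rewrite /diffq; ring.
have := l2normB (in_l2_diffq hu t0 s0) (in_l2_diffq hv t0 s0).
have := H1 s s0 st sr1; have := H2 s s0 st sr2; lra.
Qed.

Lemma l2_derivative_continuous u du : l2_derivative u du ->
  forall t, 0 <= t -> forall e : R, 0 < e -> exists2 rho : R, 0 < rho &
    forall s, 0 <= s -> `|s - t| < rho -> `|l2norm (u s) - l2norm (u t)| < e.
Proof.
move=> hu t t0 e e0; have [u1 u2 u3] := hu t t0.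
(* An error of at most 1 in the difference quotient gives the Lipschitz bound [D + 1] at [t]. *)
have [r r0 H] := u3 1 ltr01; set D := l2norm (du t).
have D0 : 0 < D + 1 by rewrite ltr_wpDl// l2norm_ge0.
exists (Num.min r (e / (D + 1))); first by rewrite lt_min r0 divr_gt0.
move=> s s0; rewrite lt_min => /andP[sr se].
have [->|st] := eqVneq s t; first by rewrite subrr normr0.
have [us _ _] := hu s s0; have hq := in_l2_diffq hu t0 s0.
apply: le_lt_trans (l2norm_dist us u1) _.
rewrite (@eq_l2norm _ _ (fun n => (s - t)%:C%C * (du t n + diffq u du t s n))).
  apply: le_lt_trans (l2normZ_le _ (in_l2D u2 hq)) _.
  move: se; rewrite ltr_pdivlMr//; apply: le_lt_trans.
  apply: ler_wpM2l => //; apply: le_trans (l2normD u2 hq) _.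
  by rewrite lerD2l ltW// H.
by move=> n; rewrite (diffq_expand u du n st) addrC addKr.
Qed.

(** At a time of contact, with [h = s - t] and error [q], the squared norm at [s] is [b ^+ 2] plus
    [2 h] times the product of [u t] with [du t + q], plus [h ^+ 2] times the squared norm of
    [du t + q]. The strictly negative first-order term wins for small [h]. *)
Lemma l2_derivative_barrier u du b : 0 <= b -> l2_derivative u du ->
  (forall t, 0 <= t -> l2norm (u t) = b -> dot (u t) (du t) < 0) ->
  l2norm (u 0) <= b -> forall t, 0 <= t -> l2norm (u t) <= b.
Proof.
move=> b0 hu hdot; apply: barrier; first exact: l2_derivative_continuous hu.
move=> t t0 ub; have [u1 u2 u3] := hu t t0.
set k := - dot (u t) (du t); have k0 : 0 < k by rewrite oppr_gt0 hdot.
have b1 : 0 < 2 * (b + 1) by lra.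
(* The bound 1 keeps the norm of [du t + q] below [D + 1]; the other makes twice the product of
   [u t] with the error at most [k]. Using [b + 1] avoids dividing by zero. *)
pose e := Num.min 1 (k / (2 * (b + 1))).
have e0 : 0 < e by rewrite lt_min ltr01 divr_gt0.
have [e1 e2] : e <= 1 /\ e * (2 * (b + 1)) <= k.
  by rewrite -ler_pdivlMr// /e !ge_min !lexx orbT.
have [r r0 H] := u3 e e0; set D := l2norm (du t).
have D0 : 0 <= D by exact: l2norm_ge0.
have D1 : 0 < (D + 1) ^+ 2 by rewrite exprn_gt0// ltr_wpDl.
(* The second bound makes the quadratic term cost at most [h * k], so both errors together are
   absorbed by [- 2 * h * k]. *)
exists (Num.min r (k / (D + 1) ^+ 2)); first by rewrite lt_min r0 divr_gt0.
move=> s ts; rewrite -ltrBlDl lt_min ltr_pdivlMr// => /andP[sr sk].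
have s0 : 0 <= s by rewrite (le_trans t0 (ltW ts)).
have st : s != t by rewrite gt_eqF.
have h0 : 0 < s - t by rewrite subr_gt0.
have hq := in_l2_diffq hu t0 s0; have hdq := in_l2D u2 hq.
have qe : l2norm (diffq u du t s) < e by apply: H => //; rewrite gtr0_norm.
have q0 := l2norm_ge0 (diffq u du t s).
rewrite -(@ler_pXn2r _ 2)// ?nnegrE ?l2norm_ge0//.
rewrite (@eq_l2norm _ _ (fun n => u t n + (s - t)%:C%C * (du t n + diffq u du t s n))).
  rewrite (dotDD u1 (in_l2Z _ hdq)) (dotZr _ u1 hdq) (dotDr u1 u2 hq).
  rewrite (l2normZ_sqr _ hdq) ub.
  have cs := dot_le u1 hq; rewrite ub in cs.
  have nn : l2norm (fun n => du t n + diffq u du t s n) ^+ 2 <= (D + 1) ^+ 2.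
    rewrite lerXn2r ?nnegrE ?l2norm_ge0 ?addr_ge0//.
    by apply: le_trans (l2normD u2 hq) _; rewrite lerD2l; lra.
  have dk : dot (u t) (du t) = - k by rewrite opprK.
  rewrite dk; move: nn cs; set X := l2norm _ ^+ 2; set d := dot _ _; set h := s - t.
  set q := l2norm _ in qe q0 * => nn cs.
  have d2 : 2 * d <= k by nra.
  have hX : h * X <= k by apply: le_trans (ltW sk); rewrite ler_pM2l.
  have : h * (- k * 2 + 2 * d + h * X) <= 0.
    by rewrite pmulr_rle0//; lra.
  by nra.
by move=> n; exact: diffq_expand.
Qed.
End Evolution.

(** * Energy identity on the lattice and estimates of the cubic terms *)

Section Lattice.
Variable R : realType.
Implicit Types (u v w du : int -> R[i]).
Local Notation normc := ComplexField.Normc.normc.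

(* Pairing with [u] cancels the discrete Laplacian (its contribution
   telescopes) and leaves the damping and the source. *)
Lemma dot_lattice (delta : R) u du w : in_l2 u -> in_l2 w ->
  (forall n, 'i%C * du n = (u (n + 1) - 2 * u n + u (n - 1))
                           - 'i%C * delta%:C%C * u n + w n) ->
  dot u du = - delta * l2norm u ^+ 2 - dot u (fun n => 'i%C * w n).
Proof.
move=> hu hw hdu; have hiw := in_l2i hw.
pose A n := rip (u n) (u n); pose B n := rip (u n) ('i%C * w n).
(* Since [rip z ('i * w)] is antisymmetric in [z] and [w], the two neighbours contribute [- c n] and
   [c (n - 1)], the central term contributes nothing, and the shifted sums cancel. *)
pose c n := rip (u n) ('i%C * u (n + 1)).
have hA : abssum A by exact: abssum_rip.
have hB : abssum B by exact: abssum_rip.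
have hc : abssum c by apply: abssum_rip => //; apply/in_l2i/in_l2_shift.
have hc' : abssum (fun n => c (n - 1)) by exact: (abssum_reindex (bij_addz (- 1)) hc).
rewrite /dot (@eq_sumR _ _ _ (fun n => (- delta * A n + - B n) + (- c n + c (n - 1)))).
  have nB := abssumN hB; have nc := abssumN hc; have dA := abssumZ (- delta) hA.
  rewrite (sumRD (abssumD dA nB) (abssumD nc hc')) (sumRD dA nB) (sumRD nc hc').
  rewrite (sumRZ _ hA) (sumRN hB) (sumRN hc).
  have -> : sumR (fun n => c (n - 1)) = sumR c.
    exact: (sumR_reindex _ (bij_addz (- 1))).
  have -> : sumR A = l2norm u ^+ 2 by exact: dot_self.
  by rewrite addNr addr0.
move=> n; have /(congr1 (fun z => - ('i%C * z))) := hdu n.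
rewrite mulrA -expr2 sqr_i mulN1r opprK => ->.
rewrite /A /B /c /rip subrK; move: (u n) (u (n + 1)) (u (n - 1)) (w n).
by move=> [a1 a2] [b1 b2] [c1 c2] [d1 d2] /=; ring.
Qed.

(** By Cauchy-Schwarz the product is at most [- delta * b ^+ 2] plus [b] times the norm of [w]. This
    supplies the contact condition of [l2_derivative_barrier]. *)
Lemma dot_lattice_lt0 (delta : R) u du w (b : R) : in_l2 u -> in_l2 w ->
  (forall n, 'i%C * du n = (u (n + 1) - 2 * u n + u (n - 1))
                           - 'i%C * delta%:C%C * u n + w n) ->
  0 < b -> l2norm u = b -> l2norm w < delta * b -> dot u du < 0.
Proof.
move=> hu hw hdu b0 ub wb; rewrite (dot_lattice hu hw hdu) ub.
have hiw := in_l2i hw.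
have : - dot u (fun n => 'i%C * w n) <= b * l2norm w.
  rewrite -mulN1r -dotZr//; apply: le_trans (dot_le hu (in_l2Z _ hiw)) _.
  rewrite ub ler_pM2l//; apply: le_trans (l2normZ_le _ hiw) _.
  by rewrite normrN1 mul1r l2normi.
have : b * l2norm w < b * (delta * b) by rewrite ltr_pM2l.
by rewrite expr2; lra.
Qed.

Lemma normc_cubic_le (m : R) u v n : in_l2 u ->
  normc (m%:C%C * `|u n| ^+ 2 * v n) <= `|m| * l2norm u ^+ 2 * normc (v n).
Proof.
move=> hu; have -> : `|u n| = (normc (u n))%:C%C by [].
rewrite -rmorphXn -rmorphM normcZ ler_wpM2r ?normc_ge0//.
rewrite normrM ler_wpM2l// ger0_norm ?sqr_ge0//.
by rewrite lerXn2r ?nnegrE ?normc_ge0 ?l2norm_ge0// normc_le_l2norm.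
Qed.

Lemma in_l2_cubic (m : R) u v : in_l2 u -> in_l2 v ->
  in_l2 (fun n => m%:C%C * `|u n| ^+ 2 * v n).
Proof.
move=> hu; apply: (@in_l2_dom _ (`|m| * l2norm u ^+ 2)) => [|n].
  by rewrite mulr_ge0// sqr_ge0.
exact: normc_cubic_le.
Qed.

Lemma l2norm_cubic (m : R) u v : in_l2 u -> in_l2 v ->
  l2norm (fun n => m%:C%C * `|u n| ^+ 2 * v n) <= `|m| * l2norm u ^+ 2 * l2norm v.
Proof.
move=> hu; apply: l2norm_dom => [|n]; last exact: normc_cubic_le.
by rewrite mulr_ge0// sqr_ge0.
Qed.

Lemma in_l2_neighbours u : in_l2 u -> in_l2 (fun n => u (n + 1) + u (n - 1)).
Proof. by move=> hu; apply: in_l2D; exact: in_l2_shift. Qed.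

(** The factor 2 counts the two neighbours, since shifts preserve the norm. *)
Lemma l2norm_cubicAL (mu b : R) u : in_l2 u -> l2norm u <= b ->
  l2norm (fun n => mu%:C%C * `|u n| ^+ 2 * (u (n + 1) + u (n - 1)))
    <= 2 * `|mu| * b ^+ 3.
Proof.
move=> hu ub; have u0 := l2norm_ge0 u.
apply: le_trans (l2norm_cubic _ hu (in_l2_neighbours hu)) _.
have -> : 2 * `|mu| * b ^+ 3 = `|mu| * b ^+ 2 * (b + b) by ring.
apply: ler_pM; rewrite ?mulr_ge0 ?sqr_ge0 ?l2norm_ge0//.
  by rewrite ler_wpM2l// lerXn2r// nnegrE// (le_trans u0).
apply: le_trans (l2normD (in_l2_shift _ hu) (in_l2_shift _ hu)) _.
by rewrite !l2norm_shift// lerD.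
Qed.

Lemma l2norm_cubicNLS (gamma b : R) u : in_l2 u -> l2norm u <= b ->
  l2norm (fun n => gamma%:C%C * `|u n| ^+ 2 * u n) <= `|gamma| * b ^+ 3.
Proof.
move=> hu ub; have u0 := l2norm_ge0 u.
apply: le_trans (l2norm_cubic _ hu hu) _.
have -> : `|gamma| * b ^+ 3 = `|gamma| * b ^+ 2 * b by ring.
apply: ler_pM; rewrite ?mulr_ge0 ?sqr_ge0//.
by rewrite ler_wpM2l// lerXn2r// nnegrE// (le_trans u0).
Qed.
End Lattice.

(** * A priori bounds for the two equations and for their difference *)

Section Solutions.
Variables (R : realType) (delta mu gamma : R) (g : int -> R[i]).
Hypothesis hg : in_l2 g.
Implicit Types (psi phi : R -> int -> R[i]) (b : R).

(** The smallness condition says that on the sphere of radius [b] the damping beats the cubic term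
    and [g] together. *)
Lemma dfAL_bound psi b : 0 < b -> dfAL_solution delta mu g psi ->
  2 * `|mu| * b ^+ 3 + l2norm g < delta * b ->
  l2norm (psi 0) <= b -> forall t, 0 <= t -> l2norm (psi t) <= b.
Proof.
move=> b0 [dpsi /is_C1_l2_derivative hpsi eqn] small.
apply: l2_derivative_barrier (hpsi) _ => [|t t0 tb]; first exact: ltW.
have [h1 h2 _] := hpsi t t0.
have hw := in_l2_cubic mu h1 (in_l2_neighbours h1).
apply: (@dot_lattice_lt0 _ delta _ _ (fun n =>
  mu%:C%C * `|psi t n| ^+ 2 * (psi t (n + 1) + psi t (n - 1)) + g n) b) => //.
- exact: in_l2D.
- by move=> n; rewrite eqn//; ring.
apply: le_lt_trans (l2normD hw hg) _; apply: le_lt_trans _ small.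
by rewrite lerD2r l2norm_cubicAL// tb.
Qed.

Lemma dfDNLS_bound phi b : 0 < b -> dfDNLS_solution delta gamma g phi ->
  `|gamma| * b ^+ 3 + l2norm g < delta * b ->
  l2norm (phi 0) <= b -> forall t, 0 <= t -> l2norm (phi t) <= b.
Proof.
move=> b0 [dphi /is_C1_l2_derivative hphi eqn] small.
apply: l2_derivative_barrier (hphi) _ => [|t t0 tb]; first exact: ltW.
have [h1 h2 _] := hphi t t0.
have hw := in_l2_cubic gamma h1 h1.
apply: (@dot_lattice_lt0 _ delta _ _ (fun n =>
  gamma%:C%C * `|phi t n| ^+ 2 * phi t n + g n) b) => //.
- exact: in_l2D.
- by move=> n; rewrite eqn//; ring.
apply: le_lt_trans (l2normD hw hg) _; apply: le_lt_trans _ small.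
by rewrite lerD2r l2norm_cubicNLS// tb.
Qed.

(* The linear part and the forcing cancel in the difference, which is thus
   damped and driven by the two cubic terms only. *)
Lemma dfDNLS_dfAL_distance psi phi b d : 0 < d ->
  dfAL_solution delta mu g psi -> dfDNLS_solution delta gamma g phi ->
  (forall t, 0 <= t -> l2norm (psi t) <= b) ->
  (forall t, 0 <= t -> l2norm (phi t) <= b) ->
  (`|gamma| + 2 * `|mu|) * b ^+ 3 < delta * d ->
  l2norm (fun n => phi 0 n - psi 0 n) <= d ->
  forall t, 0 <= t -> l2norm (fun n => phi t n - psi t n) <= d.
Proof.
move=> d0 [dpsi /is_C1_l2_derivative hpsi eqpsi].
move=> [dphi /is_C1_l2_derivative hphi eqphi] bpsi bphi small.
apply: (l2_derivative_barrier (ltW d0) (l2_derivativeB hphi hpsi)) => t t0 td.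
have [f1 f2 _] := hphi t t0; have [p1 p2 _] := hpsi t t0.
have hf := in_l2_cubic gamma f1 f1.
have hp := in_l2_cubic mu p1 (in_l2_neighbours p1).
(* The difference obeys the same linear lattice equation. Its two cubic sources are bounded
   separately, each by a multiple of [b ^+ 3]. *)
apply: (@dot_lattice_lt0 _ delta _ _ (fun n =>
  gamma%:C%C * `|phi t n| ^+ 2 * phi t n
  - mu%:C%C * `|psi t n| ^+ 2 * (psi t (n + 1) + psi t (n - 1))) d) => //.
- exact: in_l2B.
- exact: in_l2B.
- by move=> n; rewrite mulrBr eqphi// eqpsi//; ring.
apply: le_lt_trans (l2normB hf hp) _; apply: le_lt_trans _ small.
rewrite mulrDl; apply: lerD; first by rewrite l2norm_cubicNLS// bphi.
by rewrite l2norm_cubicAL// bpsi.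
Qed.
End Solutions.

(** * Choice of the constants and conclusion *)

Theorem mainTheorem1 (R : realType) (delta mu gamma : R) (g : int -> R[i])
    (K_phi : R) (hdelta : 0 < delta) (hg : in_l2 g) (hK : 0 < K_phi) :
  forall t0 : R, 0 < t0 ->
  exists eps0 C0 C : R, [/\ 0 < eps0, 0 < C0, 0 < C &
    forall eps : R, 0 < eps -> eps < eps0 ->
    forall psi phi : R -> int -> R[i],
      dfAL_solution delta mu g psi ->
      dfDNLS_solution delta gamma g phi ->
      l2norm (fun n => phi 0 n - psi 0 n) <= C0 * eps ^+ 3 ->
      2 / delta * l2norm g <= l2norm (phi 0) ->
      l2norm (phi 0) <= K_phi * eps ->
      forall t : R, 0 <= t -> t <= t0 ->
        l2norm (fun n => phi t n - psi t n) <= C * eps ^+ 3].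
Proof.
move=> t0 t0_gt0.
(* The extra 1 in [M] absorbs the initial distance between [phi] and [psi] and leaves room for
   strict inequalities; [A] dominates both cubic coefficients. *)
pose M := K_phi + 1; pose A := `|gamma| + 2 * `|mu|.
have M0 : 0 < M by rewrite addr_gt0.
have A0 : 0 <= A by rewrite addr_ge0// mulr_ge0.
have AM0 : 0 < 2 * (A + 1) * M ^+ 2 by rewrite mulr_gt0 ?exprn_gt0//; lra.
(* The quotient is the radius, in units of [eps ^+ 3], at which damping balances the cubic source;
   adding 1 makes damping win strictly and gives [C >= 1], the value chosen for [C0]. *)
pose C := A * M ^+ 3 / delta + 1.
have C1 : 1 <= C by rewrite lerDr divr_ge0 ?(ltW hdelta)// mulr_ge0// exprn_ge0// ltW.
(* The second bound yields [A * (M * eps) ^+ 2 <= delta / 2] once [eps < 1]; [A + 1] keeps the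
   denominator positive when both coefficients vanish. *)
exists (Num.min 1 (delta / (2 * (A + 1) * M ^+ 2))), 1, C; split=> //.
- by rewrite lt_min ltr01 divr_gt0.
- lra.
move=> eps e0; rewrite lt_min ltr_pdivlMr// => /andP[e1 e2].
move=> psi phi hpsi hphi hd hgphi hphi0 t tt0 _.
have e30 : 0 < eps ^+ 3 by rewrite exprn_gt0.
have b0 : 0 < M * eps by rewrite mulr_gt0.
(* Half of the damping absorbs the cubic term. The other half absorbs [g], bounded through the
   two-sided condition on [phi 0], with a margin of [delta / 2 * eps] since [M] exceeds [K_phi] by
   1. *)
have small : A * (M * eps) ^+ 3 + l2norm g < delta * (M * eps).
  have gK : l2norm g <= delta / 2 * (K_phi * eps).
    have := le_trans hgphi hphi0.
    by rewrite -ler_pdivlMl ?divr_gt0// invf_div mulrC.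
  have AM : A * (M * eps) ^+ 2 <= delta / 2.
    have ee : eps ^+ 2 <= eps by rewrite expr2 ger_pMr// ltW.
    have M2 : 0 < M ^+ 2 by rewrite exprn_gt0.
    have : A * M ^+ 2 * eps ^+ 2 <= A * M ^+ 2 * eps.
      by rewrite ler_wpM2l// mulr_ge0// ltW.
    have : 0 < M ^+ 2 * eps by rewrite mulr_gt0.
    by rewrite exprMn; lra.
  have : A * (M * eps) ^+ 3 <= delta / 2 * (M * eps).
    have -> : A * (M * eps) ^+ 3 = A * (M * eps) ^+ 2 * (M * eps) by ring.
    by rewrite ler_wpM2r// ltW.
  have : 0 < delta * eps by rewrite mulr_gt0.
  by move: gK; rewrite /M; lra.
have b30 : 0 <= (M * eps) ^+ 3 by rewrite exprn_ge0// ltW.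
have [hphi00 hpsi00] : in_l2 (phi 0) /\ in_l2 (psi 0).
  split; [case: hphi => ? /(_ 0 (lexx _))[]//|case: hpsi => ? /(_ 0 (lexx _))[]//].
apply: (@dfDNLS_dfAL_distance _ delta mu gamma g _ _ (M * eps)) => //.
- by rewrite mulr_gt0//; lra.
- apply: dfAL_bound (hpsi) _ _ => //.
    apply: le_lt_trans _ small; rewrite lerD2r ler_wpM2r// /A lerDr//.
  (* The size of [psi 0] is controlled only through [phi 0] and the initial distance, which is at
     most [eps ^+ 3 <= eps]. *)
  rewrite (@eq_l2norm _ _ (fun n => phi 0 n - (phi 0 n - psi 0 n))); last first.
    by move=> n; rewrite subKr.
  apply: le_trans (l2normB hphi00 (in_l2B hphi00 hpsi00)) _.
  have : eps ^+ 3 <= eps by rewrite exprSr ger_pMl// exprn_ile1// ltW.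
  by rewrite /M; lra.
- apply: dfDNLS_bound (hphi) _ _ => //.
    apply: le_lt_trans _ small; rewrite lerD2r ler_wpM2r// /A lerDl mulr_ge0//.
  by apply: le_trans hphi0 _; rewrite /M; lra.
- have -> : delta * (C * eps ^+ 3) = A * (M * eps) ^+ 3 + delta * eps ^+ 3.
    by rewrite /C; field; rewrite gt_eqF.
  by rewrite ltrDl mulr_gt0.
by apply: le_trans hd _; rewrite ler_pM2r.
Qed.
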